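(* Let $\mathsf{K}$ be a finitely generated variety consisting of generalized Sugihara monoids, or a finitely generated variety consisting of bounded generalized Sugihara monoids. Then every $\mathsf{K}$-epimorphism is surjective.
   Context: A commutative residuated lattice (CRL) is an algebra $\langle A;\cdot,\to,\wedge,\vee,e\rangle$ such that $\langle A;\wedge,\vee\rangle$ is a lattice, $\langle A;\cdot,e\rangle$ is a commutative monoid, and $x\cdot y\leqslant z\iff x\leqslant y\to z$, where $\leqslant$ is the lattice order. It is idempotent if $a\cdot a=a$ for all $a$. A generalized Sugihara monoid is a subdirect product of totally ordered idempotent CRLs (not necessarily integral, i.e., $e$ need not be the greatest element) that is generated by the lower bounds of its neutral element $e$; for such a subdirect product, the generation condition is known to be equivalent to satisfaction of the identity $((x\vee e)\to e)\to e\approx x\vee e$. A bounded generalized Sugihara monoid is the expansion of a generalized Sugihara monoid by a distinguished element $\bot$ that is the least element of its order. A variety is finitely generated if it is generated by some finite algebra. A class $\mathsf{K}$ of similar algebras is regarded as a category whose morphisms are all algebraic homomorphisms between members of $\mathsf{K}$. A $\mathsf{K}$-morphism $h\colon A\to B$ is a $\mathsf{K}$-epimorphism if, for all $\mathsf{K}$-morphisms $f,g$ from $B$ to a single member of $\mathsf{K}$, $f\circ h=g\circ h$ implies $f=g$. *)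

(* Defs.v *)
From Stdlib Require Export FinFun.

Set Implicit Arguments.
Unset Strict Implicit.

(** Algebras in the language of residuated lattices, expanded by distinguished
    elements named by the symbols in [C]: [C := no_symbol] for the plain
    language, [C := bottom_symbol] for the bounded one. *)

Record algebra (C : Type) := Algebra {
  carrier :> Type;
  mul : carrier -> carrier -> carrier;
  imp : carrier -> carrier -> carrier;
  meet : carrier -> carrier -> carrier;
  join : carrier -> carrier -> carrier;
  neutral : carrier;
  constant : C -> carrier
}.

Arguments neutral {C} _.
Arguments constant {C} _ _.

Inductive no_symbol : Set := .
Inductive bottom_symbol : Set := Bot.

Section UniversalAlgebra.

Context {C : Type}.
Implicit Types A B D : algebra C.

Definition is_hom A B (h : A -> B) : Prop :=
  (forall x y, h (mul x y) = mul (h x) (h y)) /\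
  (forall x y, h (imp x y) = imp (h x) (h y)) /\
  (forall x y, h (meet x y) = meet (h x) (h y)) /\
  (forall x y, h (join x y) = join (h x) (h y)) /\
  h (neutral A) = neutral B /\
  (forall c, h (constant A c) = constant B c).

Definition is_subuniverse A (S : A -> Prop) : Prop :=
  (forall x y, S x -> S y -> S (mul x y)) /\
  (forall x y, S x -> S y -> S (imp x y)) /\
  (forall x y, S x -> S y -> S (meet x y)) /\
  (forall x y, S x -> S y -> S (join x y)) /\
  S (neutral A) /\
  (forall c, S (constant A c)).

Definition generated_by A (X : A -> Prop) : Prop :=
  forall S : A -> Prop,
    is_subuniverse S -> (forall x, X x -> S x) -> forall x, S x.

Definition product (I : Type) (B : I -> algebra C) : algebra C :=
  {| carrier := forall i, B i;
     mul := fun x y i => mul (x i) (y i);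
     imp := fun x y i => imp (x i) (y i);
     meet := fun x y i => meet (x i) (y i);
     join := fun x y i => join (x i) (y i);
     neutral := fun i => neutral (B i);
     constant := fun c i => constant (B i) c |}.

Definition is_subdirect_embedding A (I : Type) (B : I -> algebra C)
    (h : A -> product B) : Prop :=
  is_hom h /\ Injective h /\ (forall i, Surjective (fun x => h x i)).

Inductive term : Type :=
  | Var (n : nat)
  | Mul (s t : term)
  | Imp (s t : term)
  | Meet (s t : term)
  | Join (s t : term)
  | Neutral
  | Constant (c : C).

Fixpoint eval A (v : nat -> A) (t : term) : A :=
  match t with
  | Var n => v n
  | Mul s t => mul (eval v s) (eval v t)
  | Imp s t => imp (eval v s) (eval v t)
  | Meet s t => meet (eval v s) (eval v t)
  | Join s t => join (eval v s) (eval v t)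
  | Neutral => neutral A
  | Constant c => constant A c
  end.

Definition satisfies A (s t : term) : Prop :=
  forall v : nat -> A, eval v s = eval v t.

Definition is_variety (K : algebra C -> Prop) : Prop :=
  exists E : term -> term -> Prop,
    forall A, K A <-> (forall s t, E s t -> satisfies A s t).

Definition variety_generated_by (K : algebra C -> Prop) A : Prop :=
  is_variety K /\ K A /\
  (forall V, is_variety V -> V A -> forall B, K B -> V B).

Definition is_finitely_generated_variety (K : algebra C -> Prop) : Prop :=
  exists A, Finite A /\ variety_generated_by K A.

Definition is_epimorphism (K : algebra C -> Prop) A B (h : A -> B) : Prop :=
  K A /\ K B /\ is_hom h /\
  (forall D, K D -> forall f g : B -> D, is_hom f -> is_hom g ->
    (forall x, f (h x) = g (h x)) -> forall y, f y = g y).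

End UniversalAlgebra.

Arguments term : clear implicits.

Definition le {C : Type} {A : algebra C} (x y : A) : Prop := meet x y = x.

Definition is_lattice (A : algebra no_symbol) : Prop :=
  (forall x y : A, meet x y = meet y x) /\
  (forall x y : A, join x y = join y x) /\
  (forall x y z : A, meet x (meet y z) = meet (meet x y) z) /\
  (forall x y z : A, join x (join y z) = join (join x y) z) /\
  (forall x y : A, meet x (join x y) = x) /\
  (forall x y : A, join x (meet x y) = x).

Definition is_comm_monoid (A : algebra no_symbol) : Prop :=
  (forall x y z : A, mul x (mul y z) = mul (mul x y) z) /\
  (forall x y : A, mul x y = mul y x) /\
  (forall x : A, mul x (neutral A) = x).

Definition is_CRL (A : algebra no_symbol) : Prop :=
  is_lattice A /\ is_comm_monoid A /\
  (forall x y z : A, le (mul x y) z <-> le x (imp y z)).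

Definition is_idempotent (A : algebra no_symbol) : Prop :=
  forall x : A, mul x x = x.

Definition is_totally_ordered (A : algebra no_symbol) : Prop :=
  forall x y : A, le x y \/ le y x.

(** Subdirect products are understood up to isomorphism. *)
Definition is_GSM (A : algebra no_symbol) : Prop :=
  (exists (I : Type) (B : I -> algebra no_symbol) (h : A -> product B),
      (forall i, is_CRL (B i) /\ is_idempotent (B i) /\
                 is_totally_ordered (B i)) /\
      is_subdirect_embedding h) /\
  generated_by (fun x : A => le x (neutral A)).

Definition reduct {C : Type} (A : algebra C) : algebra no_symbol :=
  {| carrier := A;
     mul := @mul C A;
     imp := @imp C A;
     meet := @meet C A;
     join := @join C A;
     neutral := neutral A;
     constant := fun c : no_symbol => match c with end |}.

Definition is_bounded_GSM (A : algebra bottom_symbol) : Prop :=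
  is_GSM (reduct A) /\ (forall x : A, le (constant A Bot) x).

(* Main.v *)
Require Import Defs.
From Corelib Require Import ssreflect ssrfun ssrbool.
From mathcomp Require Import boolp classical_sets.

Set Implicit Arguments.
Unset Strict Implicit.
Unset Printing Implicit Defensive.

(** Let [h] be an epimorphism into [B], and let [S] be its image, a subalgebra
    such that homomorphisms from [B] into the variety are determined by their
    restrictions to [S] ([epic_in]). Congruences of [B] come from filters of the
    negative cone, and the quotient by a prime filter is a chain, because
    [(x ==> y) `&` e] and [(y ==> x) `&` e] join to [e]. The proof compares [S]
    with [B] modulo one prime filter, then modulo two, then globally.

    One filter ([chain_epic_full]). On an idempotent chain all the operations
    are determined by the order and the star [x^* := x ==> e]. If a subalgebra
    [T] of a chain in the variety misses some [x < e], the elements of [T]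
    strictly between [x] and [e] can be identified with [e] by a congruence that
    does not identify [x] with [e]. In the quotient no element of the image of
    [T] lies in the interval from [x] up to, but excluding, [e]; sending to [e]
    everything that the image of [T] fails to separate from [e] is then an
    endomorphism ([collapse]). It fixes the image of [T] and moves that of [x],
    so [T] is not epic. Negative elements suffice here: generation by the
    negative cone forces [x^*^* = x] for [e <= x]. Hence [S] maps onto every
    chain quotient of [B].

    Two filters ([epic_interpolation]). If [S] maps onto [B/P] and [B/Q], then
    every element of [B] is congruent, modulo [P] and [Q] simultaneously, to one
    of [S]. Going from [x] to [S] modulo [P], inside [S] modulo [Q], and back
    modulo [P] defines a congruence of [B], because congruences permute by means
    of a term. Two homomorphisms into the quotient
    are compared: one sends [x] to its own class, the other to the class of any
    element of [S] congruent to [x] modulo [Q]. They agree on [S], hence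
    everywhere, and one more permutation yields the common approximation.

    Globally ([epic_full]). Fix [b], and let [I] consist of the negative [a]
    such that some [s] in [S] agrees with [b] modulo the filter generated by
    [a]. The lattice median is a majority term, so [I] contains the join of
    three elements as soon as it contains their pairwise joins. For such an [I],
    as in the Baker-Pixley theorem, two prime filters are enough to detect that
    [e] is not in [I] ([prime_pair_avoiding]); interpolation excludes such a
    pair, so [e] is in [I], which means that [b] is in [S]. *)

Declare Scope crl_scope.
Local Open Scope crl_scope.
Notation "x <= y" := (le x y) : crl_scope.
Notation "x * y" := (mul x y) : crl_scope.
Notation "x ==> y" := (imp x y) : crl_scope.
Notation "x `&` y" := (meet x y) : crl_scope.
Notation "x `|` y" := (join x y) : crl_scope.
Local Notation e := (neutral _).
Local Notation "x ^*" := (x ==> e) (at level 2, format "x ^*") : crl_scope.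

(** * Homomorphic images and quotients *)

Section Varieties.

Context {C : Type}.
Implicit Types A B D : algebra C.

Lemma hom_comp A B D (f : A -> B) (g : B -> D) :
  is_hom f -> is_hom g -> is_hom (fun x => g (f x)).
Proof.
move=> [fM [fI [fm [fj [fe fc]]]]] [gM [gI [gm [gj [ge gc]]]]].
by do ![split=> *]; rewrite ?(fM, fI, fm, fj, fe, fc).
Qed.

Lemma hom_le A B (h : A -> B) x y : is_hom h -> x <= y -> h x <= h y.
Proof. by move=> [_ [_ [hm _]]]; rewrite /le -hm => ->. Qed.

Lemma variety_hom_image K A B (q : A -> B) :
  is_variety K -> K A -> is_hom q -> Surjective q -> K B.
Proof.
move=> [E KE] /KE EA [qM [qI [qm [qj [qe qc]]]]] qsurj.
have [s sK] := choice qsurj.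
have evalq v t : q (eval (fun n => s (v n)) t) = eval v t.
  elim: t => [n|t IHt u IHu|t IHt u IHu|t IHt u IHu|t IHt u IHu||c] /=;
    by rewrite ?sK ?qM ?qI ?qm ?qj ?IHt ?IHu ?qe ?qc.
by apply/KE => t u /EA tu v; rewrite -!evalq tu.
Qed.

Definition is_congruence A (R : A -> A -> Prop) : Prop :=
  (forall x, R x x) /\
  (forall x y, R x y -> R y x) /\
  (forall x y z, R x y -> R y z -> R x z) /\
  (forall x x' y y', R x x' -> R y y' ->
     R (x * y) (x' * y') /\ R (x ==> y) (x' ==> y') /\
     R (x `&` y) (x' `&` y') /\ R (x `|` y) (x' `|` y')).

Lemma quotient_by A (R : A -> A -> Prop) : is_congruence R ->
  exists (D : algebra C) (q : A -> D),
    is_hom q /\ Surjective q /\ forall x y, q x = q y <-> R x y.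
Proof.
move=> [Rrefl [Rsym [Rtrans Rcompat]]].
pose T := {X : A -> Prop | exists x, X = R x}.
(* classes are predicates, so extensionality turns [R] into equality *)
pose cls x : T := exist _ (R x) (ex_intro _ x erefl).
have clsP x y : cls x = cls y <-> R x y.
  split=> [[->]|xy]; first exact: Rrefl.
  apply: eq_exist; apply: funext => z; apply: propext.
  by split=> [/(Rtrans _ _ _ (Rsym _ _ xy))|/(Rtrans _ _ _ xy)].
have surj : forall X : T, exists x, cls x = X.
  by move=> [X [x eX]]; exists x; apply: eq_exist.
have [rep repK] := choice surj.
have repR x : R x (rep (cls x)) by apply/clsP; rewrite repK.
exists (Algebra (fun X Y => cls (rep X * rep Y))
  (fun X Y => cls (rep X ==> rep Y)) (fun X Y => cls (rep X `&` rep Y))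
  (fun X Y => cls (rep X `|` rep Y)) (cls e) (fun c => cls (constant A c))).
exists cls; split; last by [].
by do ![split=> //=]; move=> x y; apply/clsP;
  case: (Rcompat _ _ _ _ (repR x) (repR y)) => ? [? []].
Qed.

End Varieties.

(** * Order and residuation *)

Section CRL.

Context {C : Type} {A : algebra C}.
Hypothesis crlA : is_CRL (reduct A).
Implicit Types x y z a b : A.

Lemma meetC x y : x `&` y = y `&` x.
Proof. by case: crlA => -[+ _] _; apply. Qed.

Lemma joinC x y : x `|` y = y `|` x.
Proof. by case: crlA => -[_ [+ _]] _; apply. Qed.

Lemma meetA x y z : x `&` (y `&` z) = (x `&` y) `&` z.
Proof. by case: crlA => -[_ [_ [+ _]]] _; apply. Qed.

Lemma joinA x y z : x `|` (y `|` z) = (x `|` y) `|` z.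
Proof. by case: crlA => -[_ [_ [_ [+ _]]]] _; apply. Qed.

Lemma meetjoinK x y : x `&` (x `|` y) = x.
Proof. by case: crlA => -[_ [_ [_ [_ [+ _]]]]] _; apply. Qed.

Lemma joinmeetK x y : x `|` (x `&` y) = x.
Proof. by case: crlA => -[_ [_ [_ [_ [_ +]]]]] _; apply. Qed.

Lemma mulA x y z : x * (y * z) = (x * y) * z.
Proof. by case: crlA => _ [[+ _] _]; apply. Qed.

Lemma mulC x y : x * y = y * x.
Proof. by case: crlA => _ [[_ [+ _]] _]; apply. Qed.

Lemma mulx1 x : x * e = x.
Proof. by case: crlA => _ [[_ [_ +]] _]; apply. Qed.

Lemma mul1x x : e * x = x.
Proof. by rewrite mulC mulx1. Qed.

Lemma residuation x y z : x * y <= z <-> x <= y ==> z.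
Proof. by case: crlA => _ [_ +]; apply. Qed.

Lemma le_imp x y z : x * y <= z -> x <= y ==> z.
Proof. by move/residuation. Qed.

Lemma mulACA x y z t : (x * y) * (z * t) = (x * z) * (y * t).
Proof. by rewrite -!mulA (mulA y) (mulC y z) -mulA. Qed.

Lemma lexx x : x <= x.
Proof. by rewrite /le -{2}(joinmeetK x x) meetjoinK. Qed.

Lemma le_trans y x z : x <= y -> y <= z -> x <= z.
Proof. by rewrite /le => xy yz; rewrite -xy -meetA yz. Qed.

Lemma le_anti x y : x <= y -> y <= x -> x = y.
Proof. by rewrite /le => xy yx; rewrite -xy meetC yx. Qed.

Lemma meet_lel x y : x `&` y <= x.
Proof. by rewrite /le meetC meetA lexx. Qed.

Lemma meet_ler x y : x `&` y <= y.
Proof. by rewrite meetC; exact: meet_lel. Qed.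

Lemma meet_glb z x y : z <= x -> z <= y -> z <= x `&` y.
Proof. by rewrite /le => zx zy; rewrite meetA zx zy. Qed.

Lemma join_gel x y : x <= x `|` y.
Proof. exact: meetjoinK. Qed.

Lemma join_ger x y : y <= x `|` y.
Proof. by rewrite joinC; exact: join_gel. Qed.

Lemma le_joinE x y : x <= y -> x `|` y = y.
Proof. by rewrite /le => <-; rewrite joinC meetC joinmeetK. Qed.

Lemma join_lub z x y : x <= z -> y <= z -> x `|` y <= z.
Proof.
move=> xz yz; have <- : (x `|` y) `|` z = z.
  by rewrite -joinA (le_joinE yz) (le_joinE xz).
exact: join_gel.
Qed.

Lemma le_join x y z t : x <= z -> y <= t -> x `|` y <= z `|` t.
Proof.
move=> xz yt; apply: join_lub.
  exact: le_trans xz (join_gel _ _).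
exact: le_trans yt (join_ger _ _).
Qed.

Lemma imp_mul_le x y : (x ==> y) * x <= y.
Proof. by apply/residuation/lexx. Qed.

Lemma le_mulr x y z : x <= y -> x * z <= y * z.
Proof. by move=> xy; apply/residuation/(le_trans xy)/residuation/lexx. Qed.

Lemma le_mul x y z t : x <= z -> y <= t -> x * y <= z * t.
Proof.
move=> xz yt; apply: le_trans (le_mulr _ xz) _.
by rewrite !(mulC z); exact: le_mulr.
Qed.

Lemma mul_negl a x : a <= e -> a * x <= x.
Proof. by move=> /(le_mulr x); rewrite mul1x. Qed.

Lemma mul_neg a b : a <= e -> b <= e -> a * b <= e.
Proof. by move=> ae; apply/le_trans/mul_negl. Qed.

Lemma mul_joinl x y z : (x `|` y) * z = (x * z) `|` (y * z).
Proof.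
apply: le_anti.
  apply/residuation/join_lub; apply/residuation;
    [exact: join_gel | exact: join_ger].
by apply: join_lub; apply: le_mulr; [exact: join_gel | exact: join_ger].
Qed.

Lemma star_anti x y : x <= y -> y^* <= x^*.
Proof.
move=> xy; apply/residuation; apply: le_trans _ (imp_mul_le y e).
exact: le_mul (lexx _) xy.
Qed.

Lemma le_starstar x : x <= x^*^*.
Proof. by apply/residuation; rewrite mulC; exact: imp_mul_le. Qed.

Lemma star3 x : x^*^*^* = x^*.
Proof.
by apply: le_anti; [apply: star_anti; exact: le_starstar | exact: le_starstar].
Qed.

Lemma star1 : (e : A)^* = e.
Proof.
apply: le_anti; first by have := imp_mul_le (e : A) e; rewrite mulx1.
by apply/residuation; rewrite mulx1; exact: lexx.
Qed.

Lemma star_neg x : x <= e -> e <= x^*.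
Proof. by move=> /star_anti; rewrite star1. Qed.

Lemma star_pos x : e <= x -> x^* <= e.
Proof. by move=> /star_anti; rewrite star1. Qed.

(** * Filters of the negative cone *)

Definition neg_submonoid (F : A -> Prop) : Prop :=
  (forall a, F a -> a <= e) /\ F e /\ (forall a b, F a -> F b -> F (a * b)).

Definition neg_filter (F : A -> Prop) : Prop :=
  neg_submonoid F /\ (forall a b, F a -> b <= e -> a <= b -> F b).

(** For a submonoid [F] of the negative cone, the least congruence that
    identifies its elements with [e]. *)
Definition eqmod (F : A -> Prop) x y : Prop :=
  exists a, F a /\ a * x <= y /\ a * y <= x.

Lemma eqmod_congruence F : neg_submonoid F -> is_congruence (eqmod F).
Proof.
move=> [Fneg [F1 FM]]; split; [|split; [|split]].
- by move=> x; exists e; rewrite mul1x; do ![split=> //]; exact: lexx.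
- by move=> x y [a [Fa [xy yx]]]; exists a.
- move=> x y z [a [Fa [xy yx]]] [b [Fb [yz zy]]].
  exists (a * b); split; first exact: FM.
  split.
    rewrite (mulC a) -mulA; apply: le_trans _ yz.
    exact: le_mul (lexx b) xy.
  rewrite -mulA; apply: le_trans _ yx.
  exact: le_mul (lexx a) zy.
move=> x x' y y' [a [Fa [xx' x'x]]] [b [Fb [yy' y'y]]].
have Fab := FM _ _ Fa Fb.
have aba : a * b <= a by rewrite mulC; exact: mul_negl (Fneg _ Fb).
have abb : a * b <= b by exact: mul_negl (Fneg _ Fa).
have weak c u v : a * b <= c -> c * u <= v -> (a * b) * u <= v.
  by move=> abc; exact: le_trans (le_mulr u abc).
have meet_le u v u' v' : a * u <= u' -> b * v <= v' ->
    (a * b) * (u `&` v) <= u' `&` v'.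
  move=> uu' vv'; apply: meet_glb.
    exact: le_trans (le_mul (lexx _) (meet_lel _ _)) (weak _ _ _ aba uu').
  exact: le_trans (le_mul (lexx _) (meet_ler _ _)) (weak _ _ _ abb vv').
have join_le u v u' v' : a * u <= u' -> b * v <= v' ->
    (a * b) * (u `|` v) <= u' `|` v'.
  move=> uu' vv'; rewrite (mulC (a * b)) mul_joinl !(mulC _ (a * b)).
  by apply: le_join; [exact: weak aba _ | exact: weak abb _].
have imp_le u v u' v' : a * u' <= u -> b * v <= v' ->
    (a * b) * (u ==> v) <= u' ==> v'.
  move=> u'u vv'; apply: le_imp; apply: le_trans _ vv'.
  rewrite (mulC a) -!mulA; apply: le_mul (lexx b) _.
  rewrite (mulC (u ==> v)) mulA; apply: le_trans _ (imp_mul_le u v).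
  by rewrite (mulC (u ==> v)); exact: le_mulr.
split; [|split; [|split]]; exists (a * b); split=> //.
- by rewrite (mulACA _ _ x y) (mulACA _ _ x' y'); split; exact: le_mul.
- by split; exact: imp_le.
- by split; exact: meet_le.
- by split; exact: join_le.
Qed.

(** The largest negative element modulo which [x] and [y] agree. *)
Definition bires x y : A := ((x ==> y) `&` (y ==> x)) `&` e.

Lemma bires_neg x y : bires x y <= e.
Proof. exact: meet_ler. Qed.

Lemma bires_mull x y : bires x y * x <= y.
Proof. by apply/residuation/(le_trans (meet_lel _ _))/meet_lel. Qed.

Lemma bires_mulr x y : bires x y * y <= x.
Proof. by apply/residuation/(le_trans (meet_lel _ _))/meet_ler. Qed.

Lemma filter_bires F x y : neg_filter F -> eqmod F x y -> F (bires x y).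
Proof.
move=> [[Fneg _] Fup] [a [Fa [xy yx]]].
apply: (Fup _ _ Fa (bires_neg x y)).
apply: meet_glb; last exact: Fneg.
by apply: meet_glb; exact: le_imp.
Qed.

(** Congruence permutability by a Mal'cev term: modulo [F] the factor
    [bires x y] becomes [e] and [bires y z * x] falls below [z]; symmetrically
    modulo [G]. Since the connecting element is a term in [x], [y], [z], it
    stays in [T] although the filters consist of elements of [A]. *)
Lemma eqmod_permute F G (T : A -> Prop) x y z :
  neg_filter F -> neg_filter G -> is_subuniverse T ->
  T x -> T y -> T z -> eqmod F x y -> eqmod G y z ->
  exists v, T v /\ eqmod G x v /\ eqmod F v z.
Proof.
move=> Ffilt Gfilt [TM [TI [Tm [Tj [T1 _]]]]] Tx Ty Tz xy yz.
have Tbires u v : T u -> T v -> T (bires u v).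
  by move=> Tu Tv; apply: (Tm) => //; apply: (Tm); exact: TI.
pose a := bires x y; pose c := bires y z.
exists ((a * z) `|` (c * x)); split; [|split].
- by apply: Tj; apply: TM => //; exact: Tbires.
- exists c; split; first exact: filter_bires.
  split; first exact: join_ger.
  rewrite mulC mul_joinl; apply: join_lub.
    rewrite -mulA (mulC z); apply: le_trans _ (bires_mulr x y).
    exact: le_mul (lexx _) (bires_mulr y z).
  rewrite mulC; apply: le_trans (mul_negl _ (bires_neg _ _)) _.
  exact: mul_negl (bires_neg _ _).
exists a; split; first exact: filter_bires.
split; last exact: join_gel.
rewrite mulC mul_joinl; apply: join_lub.
  rewrite mulC; apply: le_trans (mul_negl _ (bires_neg _ _)) _.
  exact: mul_negl (bires_neg _ _).
rewrite -mulA (mulC x); apply: le_trans _ (bires_mull y z).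
exact: le_mul (lexx _) (bires_mull x y).
Qed.

(** * Idempotence and prime filters *)

Hypothesis idemA : is_idempotent (reduct A).

Lemma mulxx x : x * x = x.
Proof. exact: idemA. Qed.

(** By idempotence, multiplying [x * y <= e] by [x] or [y] bounds [x * y] by [x]
    and by [y], while [x `&` y] is its own square and so lies below [x * y]. *)
Lemma mul_meet x y : x * y <= e -> x * y = x `&` y.
Proof.
move=> xye; apply: le_anti.
  apply: meet_glb.
    by have := mul_negl x xye; rewrite mulC mulA mulxx.
  by have := mul_negl y xye; rewrite -mulA mulxx.
rewrite -{1}(mulxx (x `&` y)).
exact: le_mul (meet_lel _ _) (meet_ler _ _).
Qed.

Lemma mul_join x y : e <= x * y -> x * y = x `|` y.
Proof.
move=> xye; apply: le_anti.
  rewrite -(mulxx (x `|` y)).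
  exact: le_mul (join_gel _ _) (join_ger _ _).
apply: join_lub.
  by have := le_mulr x xye; rewrite mul1x (mulC (x * y)) mulA mulxx.
by have := le_mulr y xye; rewrite mul1x -mulA mulxx.
Qed.

Definition prime_filter (P : A -> Prop) : Prop :=
  neg_filter P /\
  (forall a b, a <= e -> b <= e -> P (a `|` b) -> P a \/ P b).

(** Prime filter theorem. A filter maximal among those containing [x] and
    missing [J] is prime: if [a `|` b] is in it but neither [a] nor [b] is, then
    multiplying by some [s] in it, chosen below [x], puts [a * s] and [b * s]
    into [J], hence also [(a `|` b) * s]. As [s <= x], only joins below [x] have
    to stay in [J]; this weakening is what makes [prime_pair_avoiding] work. *)
Lemma prime_filter_avoiding (J : A -> Prop) x :
  x <= e -> ~ J x ->
  (forall a b, b <= e -> a <= b -> J b -> J a) ->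
  (forall a b, a <= e -> b <= e -> J a -> J b -> a `|` b <= x ->
     J (a `|` b)) ->
  exists P, prime_filter P /\ P x /\ (forall a, P a -> ~ J a).
Proof.
move=> xe nJx Jdown Jjoin.
pose good (F : A -> Prop) :=
  neg_filter F /\ F x /\ (forall a, F a -> ~ J a).
have [P [[Pfilt [Px PJ]] Pmax]] :
    exists P, good P /\ forall Q, (P `<` Q)%classic -> ~ good Q.
  (* the empty set has to qualify because it is the union of the empty chain *)
  have [F goodF totF|P [goodP Pmax]] :=
      @Zorn_bigcup A (fun F => F = set0 \/ good F).
    case: (EM (exists F0, F F0 /\ good F0)) => [[F0 [FF0 [gF0 [F0x _]]]]|noF].
      right; have goodin G a : F G -> G a -> good G.
        by move=> FG Ga; case: (goodF G FG) => // G0; move: Ga; rewrite G0.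
      split; [split; [split; [|split]|]|split].
      - by move=> a [G FG Ga]; case: (goodin _ _ FG Ga) => -[[+ _] _] _; apply.
      - by exists F0 => //; case: gF0 => -[_ []].
      - move=> a b [G FG Ga] [H FH Hb].
        have [|] := totF G H FG FH => sub.
          have [[[_ [_ HM]] _] _] := goodin _ _ FH Hb.
          by exists H => //; apply: HM => //; exact: sub.
        have [[[_ [_ GM]] _] _] := goodin _ _ FG Ga.
        by exists G => //; apply: GM => //; exact: sub.
      - move=> a b [G FG Ga] be ab; exists G => //.
        by have [[_ Gup] _] := goodin _ _ FG Ga; exact: Gup Ga be ab.
      - by exists F0.
      - by move=> a [G FG Ga]; have [_ [_]] := goodin _ _ FG Ga; apply.
    left; apply/predeqP => a; split=> // -[G FG Ga].
    case: (goodF G FG) => [G0|gG]; first by move: Ga; rewrite G0.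
    by case: noF; exists G.
  case: goodP => [P0|gP]; last first.
    by exists P; split=> // Q /Pmax nQ gQ; apply: nQ; right.
  pose G a := a <= e /\ x <= a.
  have gG : good G.
    split; [split; [split; [|split]|]|split] => //.
    - by move=> a [].
    - by split=> //; exact: lexx.
    - move=> a b [ae xa] [be xb]; split; first exact: mul_neg.
      by rewrite -(mulxx x); exact: le_mul.
    - by move=> a b [_ xa] be ab; split=> //; exact: le_trans ab.
    - by split=> //; exact: lexx.
    - by move=> a [ae xa] Ja; apply: nJx; exact: Jdown xa Ja.
  case: (Pmax G); last by right.
  split=> [a|sub]; first by rewrite P0.
  have: P x by apply: sub; split=> //; exact: lexx.
  by rewrite P0.
exists P; split; last by [].
split=> //.
have [[Pneg [P1 PM]] Pup] := Pfilt.
have extend a : a <= e -> ~ P a -> exists p, P p /\ J (a * p).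
  move=> ae nPa; pose Q b := b <= e /\ exists2 p, P p & a * p <= b.
  apply: contrapT => noJ; apply: (Pmax Q).
    split=> [b Pb|QP].
      by split; [exact: Pneg | exists b => //; exact: mul_negl].
    apply: nPa; apply: QP; split=> //.
    by exists e; rewrite ?mulx1 //; exact: lexx.
  split; [split; [split; [|split]|]|split].
  - by move=> b [].
  - by split; [exact: lexx | exists e; rewrite ?mulx1].
  - move=> b c [be [p Pp apb]] [ce [q Pq aqc]]; split; first exact: mul_neg.
    by exists (p * q); [exact: PM | rewrite -(mulxx a) mulACA; exact: le_mul].
  - move=> b c [be [p Pp apb]] ce bc; split=> //.
    by exists p => //; exact: le_trans bc.
  - by split=> //; exists x => //; exact: mul_negl.
  move=> b [be [p Pp apb]] Jb; apply: noJ; exists p; split=> //.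
  exact: Jdown apb Jb.
move=> a b ae be Pab; apply: contrapT => /not_orP[nPa nPb].
have [p [Pp Jap]] := extend a ae nPa; have [q [Pq Jbq]] := extend b be nPb.
have shrink c r s : c <= e -> P r -> P s -> s <= r -> J (c * r) -> J (c * s).
  move=> ce Pr Ps sr; apply: Jdown; first by apply: mul_neg ce (Pneg _ Pr).
  exact: le_mul (lexx c) sr.
pose s := (p * q) * x; have Ps : P s := PM _ _ (PM _ _ Pp Pq) Px.
have sp : s <= p.
  rewrite /s -mulA mulC; apply: mul_negl; exact: mul_neg (Pneg _ Pq) xe.
have sq : s <= q.
  rewrite /s (mulC p) -mulA mulC; apply: mul_negl.
  exact: mul_neg (Pneg _ Pp) xe.
have sx : s <= x by apply: mul_negl; exact: Pneg (PM _ _ Pp Pq).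
apply: (PJ ((a `|` b) * s)); first exact: PM.
have cs c : c <= e -> c * s <= e by move=> ce; exact: mul_neg ce (Pneg _ Ps).
rewrite mul_joinl; apply: Jjoin; [exact: cs|exact: cs| | |].
- exact: shrink sp Jap.
- exact: shrink sq Jbq.
by apply: join_lub; apply: le_trans _ sx; exact: mul_negl.
Qed.

(** The majority closure says that [I] behaves like an ideal below any of its
    own elements. If [I] is closed under joins, it is an ideal and one prime
    filter does. Otherwise there are [x], [y] in [I] with [x `|` y] outside, and
    the pair ([x], [y]) is enlarged to a pair of primes one side at a time:
    joins below [x], respectively [y], are in [I], which supplies the third
    premise of the majority closure. *)
Lemma prime_pair_avoiding (I : A -> Prop) :
  (forall a b, b <= e -> a <= b -> I b -> I a) ->
  (forall a b c, a <= e -> b <= e -> c <= e ->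
     I (a `|` b) -> I (a `|` c) -> I (b `|` c) -> I (a `|` (b `|` c))) ->
  ~ I e ->
  exists P Q, prime_filter P /\ prime_filter Q /\
    (forall a, P a -> Q a -> ~ I a).
Proof.
move=> Idown Imaj nIe.
case: (EM (exists x y,
  [/\ x <= e, y <= e, I x, I y & ~ I (x `|` y)])); last first.
  move=> Ijoin; have [|a b ae be Ia Ib _|P [Pprime [_ PI]]] :=
      @prime_filter_avoiding I e (lexx e) nIe.
  - exact: Idown.
  - by apply: contrapT => nIab; apply: Ijoin; exists a, b.
  - by exists P, P; split=> //; split=> // a Pa _; exact: PI.
move=> [x [y [xe ye Ix Iy nIxy]]].
have down3 a b c : a <= b -> b <= e -> c <= e -> I (b `|` c) -> I (a `|` c).
  move=> ab be ce; apply: Idown; first exact: join_lub.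
  exact: le_join ab (lexx c).
have [|a b ae be Ja Jb abx|P [Pprime [Px PJ]]] :=
    @prime_filter_avoiding (fun a => I (a `|` y)) x xe nIxy.
- by move=> a b be ab; exact: down3.
- rewrite -joinA; apply: Imaj => //.
  exact: Idown xe abx Ix.
have [[[Pneg [P1 PM]] Pup] Pp] := Pprime.
have [|||Q [Qprime [Qy QJ]]] :=
    @prime_filter_avoiding (fun b => exists2 p, P p & I (p `|` b)) y ye.
- by move=> [p Pp' Ipy]; exact: PJ Pp' Ipy.
- move=> a b be ab [p Pp' Ipb]; exists p => //.
  by rewrite joinC; apply: down3 ab be (Pneg _ Pp') _; rewrite joinC.
- move=> a b ae be [p Pp' Ipa] [q Pq Iqb] aby; exists (p * q); first exact: PM.
  have [pe qe] := (Pneg _ Pp', Pneg _ Pq).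
  apply: Imaj => //; first exact: mul_neg.
  + by apply: down3 Ipa => //; rewrite mulC; exact: mul_negl.
  + by apply: down3 Iqb => //; exact: mul_negl.
  exact: Idown ye aby Iy.
exists P, Q; split=> //; split=> // a Pa Qa Ia.
by apply: (QJ a Qa); exists a => //; rewrite (le_joinE (lexx a)).
Qed.

(** * Chains *)

Hypothesis totA : forall x y, x <= y \/ y <= x.

Lemma nle_le x y : ~ x <= y -> y <= x.
Proof. by case: (totA x y). Qed.

Lemma meet_conserv x y : x `&` y = x \/ x `&` y = y.
Proof. by case: (totA x y) => xy; [left | right; rewrite meetC]. Qed.

Lemma join_conserv x y : x `|` y = x \/ x `|` y = y.
Proof.
case: (totA x y) => xy; first by right; exact: le_joinE.
by left; rewrite joinC; exact: le_joinE.
Qed.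

Lemma mul_conserv x y : x * y = x \/ x * y = y.
Proof.
case: (totA (x * y) e) => [/mul_meet|/mul_join] ->.
  exact: meet_conserv.
exact: join_conserv.
Qed.

Lemma imp_le_join x y : x <= y -> x ==> y = x^* `|` y.
Proof.
move=> xy; apply: le_anti; last first.
  apply: join_lub; apply/residuation.
    rewrite (mul_meet (imp_mul_le x e)).
    exact: le_trans (meet_ler _ _) xy.
  by case: (mul_conserv y x) => -> //; exact: lexx.
case: (EM (x ==> y <= y)) => [zy|nzy].
  exact: le_trans zy (join_ger _ _).
apply: le_trans _ (join_gel _ _); apply/residuation.
case: (totA ((x ==> y) * x) e) => // /mul_join zx; case: nzy.
by apply: le_trans _ (imp_mul_le x y); rewrite zx; exact: join_gel.
Qed.

Lemma imp_gt_meet x y : ~ x <= y -> x ==> y = x^* `&` y.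
Proof.
move=> nxy; have zxe : (x ==> y) * x <= e.
  case: (totA ((x ==> y) * x) e) => // /mul_join zx; case: nxy.
  by apply: le_trans _ (imp_mul_le x y); rewrite zx; exact: join_ger.
apply: le_anti; last first.
  apply/residuation; rewrite mul_meet.
    exact: le_trans (meet_lel _ _) (meet_ler _ _).
  exact: le_trans (le_mulr _ (meet_lel _ _)) (imp_mul_le _ _).
apply: meet_glb; first exact/residuation.
have := imp_mul_le x y; rewrite (mul_meet zxe).
by case: (meet_conserv (x ==> y) x) => ->.
Qed.

(** On a chain, [x * y] is the meet or the join of [x] and [y] according to
    whether [x <= y^*], and [x ==> y] is the join or the meet of [x^*] and [y]
    according to whether [x <= y]. A monotone map commuting with the star can
    disturb these conditions only by identifying elements; if it does so only at
    [e], the two formulas give the same result. *)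
Lemma chain_endomorphism (r : A -> A) :
  (forall x y, x <= y -> r x <= r y) ->
  r e = e -> (forall x, r (x^*) = (r x)^*) ->
  (forall c, r (constant A c) = constant A c) ->
  (forall x y, r x = r y -> x = y \/ r x = e) ->
  is_hom r.
Proof.
move=> rmono r1 rstar rconst rinj.
have rmeet x y : r (x `&` y) = r x `&` r y.
  case: (totA x y) => xy; first by rewrite xy (rmono _ _ xy).
  by rewrite meetC xy meetC (rmono _ _ xy).
have rjoin x y : r (x `|` y) = r x `|` r y.
  case: (totA x y) => xy; first by rewrite !le_joinE //; exact: rmono.
  by rewrite joinC (joinC (r x)) !le_joinE //; exact: rmono.
split=> [x y|].
  case: (EM (x * y <= e)) => xye.
    rewrite mul_meet // rmeet mul_meet //.
    by apply/residuation; rewrite -rstar; apply: rmono; exact: le_imp.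
  have exy := nle_le xye; rewrite mul_join // rjoin.
  case: (EM (e <= r x * r y)) => [/mul_join -> //|/nle_le rxye].
  (* the product of the images is negative although [x * y] is not, so [r]
     identifies [x] with [y^*], and [y] with [x^*]: both go to [e] *)
  have to1 u v : ~ u * v <= e -> r u * r v <= e -> r u = e.
    move=> nuv ruv; have ru : r u = r (v^*).
      apply: le_anti; first by rewrite rstar; exact: le_imp.
      by apply: rmono; apply: nle_le => uv; apply: nuv; exact/residuation.
    case: (rinj _ _ ru) => // uv; case: nuv; apply/residuation.
    by rewrite -uv; exact: lexx.
  rewrite (to1 _ _ xye rxye) mul1x (to1 y x); last 2 first.
  - by rewrite mulC.
  - by rewrite mulC.
  exact: le_joinE (lexx _).
split=> [x y|].
  case: (EM (x <= y)) => xy.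
    by rewrite (imp_le_join xy) (imp_le_join (rmono _ _ xy)) rjoin rstar.
  rewrite (imp_gt_meet xy) rmeet rstar.
  case: (EM (r x <= r y)) => rxy; last by rewrite (imp_gt_meet rxy).
  have rE : r x = r y by apply: le_anti => //; apply/rmono/nle_le.
  have [yx|rx1] := rinj _ _ rE; first by case: xy; rewrite yx; exact: lexx.
  by rewrite -rE rx1 star1 lexx.
by split; [|split; [|split]].
Qed.

(** * Collapsing an interval around the neutral element *)

Section Collapse.

Variable T : A -> Prop.
Hypothesis subT : is_subuniverse T.

(** The largest star-closed interval around [e] that meets [T] in [e] only. *)
Definition near z : Prop :=
  forall t, T t -> ~ e <= t -> ~ z <= t /\ ~ z^* <= t.

Lemma sub_star t : T t -> T (t^*).
Proof. by case: subT => _ [TI [_ [_ [T1 _]]]] Tt; apply: TI. Qed.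

Lemma near_convex x y z : near x -> near z -> x <= y -> y <= z -> near y.
Proof.
move=> nx nz xy yz t Tt nt; have [nxt _] := nx t Tt nt.
have [_ nzt] := nz t Tt nt; split=> yt.
  by apply: nxt; exact: le_trans yt.
by apply: nzt; apply: le_trans yt; exact: star_anti.
Qed.

Lemma near1 : near e.
Proof. by move=> t _ nt; rewrite star1. Qed.

Lemma near_star z : near z -> near z^*.
Proof.
move=> nz t Tt nt; have [nzt nzt'] := nz t Tt nt; split=> // zt.
by apply: nzt; apply: le_trans zt; exact: le_starstar.
Qed.

Lemma near_sub t : T t -> near t -> t = e.
Proof.
move=> Tt nt; case: (EM (e <= t)) => et; last first.
  by have [+ _] := nt t Tt et; case; exact: lexx.
case: (EM (e <= t^*)) => et'; last first.
  by have [_ +] := nt _ (sub_star Tt) et'; case; exact: lexx.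
apply: le_anti => //; apply: le_trans (le_starstar t) _.
exact: star_pos.
Qed.

(** If [z <= t < e] with [t] in [T] while [z^*] is near [e], then [t] lies below
    [z^*^*], so [t^*^* = z^*^*] belongs to [T]; being near [e], it is [e]. *)
Lemma near_star_inv z : near z^* -> near z \/ z^* = e.
Proof.
move=> nz; apply: contrapT => /not_orP[nnz nz1].
apply: nnz => t Tt nt; have [nzt nzt'] := nz t Tt nt; split=> // zt.
apply: nz1; have tz : t <= z^*^* := nle_le nzt'.
have tz' : t^*^* = z^*^*.
  apply: le_anti; last by do 2 apply: star_anti.
  by rewrite -(star3 z^*); do 2 apply: star_anti.
have z1 : z^*^* = e.
  rewrite -tz'; apply: near_sub; first by do 2 apply: sub_star.
  by rewrite tz'; exact: near_star.
by rewrite -star3 z1 star1.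
Qed.

(** The map that sends the elements near [e] to [e] and fixes the others is an
    endomorphism: convexity makes it monotone, and [near_star_inv] is what it
    takes to commute with the star. *)
Lemma collapse : exists r : A -> A,
  is_hom r /\ (forall t, T t -> r t = t) /\ (forall z, near z -> r z = e).
Proof.
pose r z := if pselect (near z) then e else z.
have r_near z : near z -> r z = e by rewrite /r; case: pselect.
have r_far z : ~ near z -> r z = z by rewrite /r; case: pselect.
have rT t : T t -> r t = t.
  move=> Tt; case: (EM (near t)) => nt; last exact: r_far.
  by rewrite r_near // (near_sub Tt).
exists r; split=> //; apply: chain_endomorphism.
- move=> x y xy; case: (EM (near x)) => nx; case: (EM (near y)) => ny.
  + by rewrite !r_near //; exact: lexx.
  + rewrite (r_near x) // (r_far y) //; apply: nle_le => ye; apply: ny.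
    exact: near_convex nx near1 xy ye.
  + rewrite (r_near y) // (r_far x) //; apply: nle_le => ex; apply: nx.
    exact: near_convex near1 ny ex xy.
  by rewrite !r_far.
- exact: r_near near1.
- move=> x; case: (EM (near x)) => nx.
    by rewrite !r_near ?star1 //; exact: near_star.
  rewrite (r_far x) //; case: (EM (near x^*)) => nx'; last exact: r_far.
  by rewrite r_near //; case: (near_star_inv nx').
- by move=> c; apply: rT; case: subT => _ [_ [_ [_ [_ +]]]]; apply.
move=> x y; case: (EM (near x)) => nx; first by rewrite r_near //; right.
case: (EM (near y)) => ny; first by rewrite (r_near y) //; right.
by rewrite !r_far //; left.
Qed.

End Collapse.

End CRL.

(** * Generalized Sugihara monoids *)

Section GSM.

Context {C : Type} {A : algebra C}.
Hypothesis gsmA : is_GSM (reduct A).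

(** The subdirect embedding, in the form in which identities transfer: it
    separates points and preserves the operations in each coordinate. *)
Lemma GSM_coordinates : exists (I : Type) (B : I -> algebra no_symbol)
    (h : A -> product B),
  (forall i, is_CRL (reduct (B i)) /\ is_idempotent (reduct (B i)) /\
             is_totally_ordered (B i)) /\
  (forall x y : A, (forall i, h x i = h y i) -> x = y) /\
  (forall i (x y : A),
     h (x * y) i = h x i * h y i /\ h (x ==> y) i = h x i ==> h y i /\
     h (x `&` y) i = h x i `&` h y i /\ h (x `|` y) i = h x i `|` h y i) /\
  (forall i, h e i = e).
Proof.
have [[I [B [h [Bchain [hhom [hinj _]]]]]] _] := gsmA.
have [hM [hI [hm [hj [he _]]]]] := hhom.
exists I, B, h; split; first exact: Bchain; split.
  by move=> x y xy; apply/hinj/functional_extensionality_dep.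
split=> i; last by rewrite he.
by move=> x y; rewrite hM hI hm hj.
Qed.

Lemma GSM_CRL : is_CRL (reduct A).
Proof.
have [I [B [h [Bchain [ext [hop he]]]]]] := GSM_coordinates.
have hM i x y : h (x * y) i = h x i * h y i by case: (hop i x y).
have hI i x y : h (x ==> y) i = h x i ==> h y i by case: (hop i x y) => _ [].
have hm i x y : h (x `&` y) i = h x i `&` h y i.
  by case: (hop i x y) => _ [_ []].
have hj i x y : h (x `|` y) i = h x i `|` h y i.
  by case: (hop i x y) => _ [_ []].
have ext_le (x y : A) : x <= y <-> forall i, h x i <= h y i.
  split=> [xy i|xy]; rewrite /le; first by rewrite -hm xy.
  by apply: ext => i; rewrite hm; exact: xy.
have crlB i : is_CRL (reduct (B i)) by case: (Bchain i).
split; [do ![split] | split; [do ![split]|]] => /=.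
- by move=> x y; apply: ext => i; rewrite !hm; exact: (meetC (crlB i)).
- by move=> x y; apply: ext => i; rewrite !hj; exact: (joinC (crlB i)).
- by move=> x y z; apply: ext => i; rewrite !hm; exact: (meetA (crlB i)).
- by move=> x y z; apply: ext => i; rewrite !hj; exact: (joinA (crlB i)).
- by move=> x y; apply: ext => i; rewrite hm hj; exact: (meetjoinK (crlB i)).
- by move=> x y; apply: ext => i; rewrite hj hm; exact: (joinmeetK (crlB i)).
- by move=> x y z; apply: ext => i; rewrite !hM; exact: (mulA (crlB i)).
- by move=> x y; apply: ext => i; rewrite !hM; exact: (mulC (crlB i)).
- by move=> x; apply: ext => i; rewrite hM he; exact: (mulx1 (crlB i)).
move=> x y z; split=> /ext_le xyz; apply/ext_le => i; have := xyz i.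
  by rewrite hM hI; apply (residuation (crlB i)).
by rewrite hM hI; apply (residuation (crlB i)).
Qed.

Lemma GSM_idempotent : is_idempotent (reduct A).
Proof.
have [I [B [h [Bchain [ext [hop _]]]]]] := GSM_coordinates.
move=> x; apply: ext => i; case: (hop i x x) => /= -> _.
by case: (Bchain i) => _ [+ _]; apply.
Qed.

Lemma GSM_prelinear (x y : A) : ((x ==> y) `&` e) `|` ((y ==> x) `&` e) = e.
Proof.
have [I [B [h [Bchain [ext [hop he]]]]]] := GSM_coordinates.
apply: ext => i.
have [_ [_ [_ ->]]] := hop i ((x ==> y) `&` e) ((y ==> x) `&` e).
have [_ [_ [-> _]]] := hop i (x ==> y) e.
have [_ [_ [-> _]]] := hop i (y ==> x) e.
have [_ [-> _]] := hop i x y; have [_ [-> _]] := hop i y x.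
rewrite !he; have [crlB [_ tot]] := Bchain i.
have le_imp u v : u <= v -> (u ==> v) `&` e = e :> B i.
  move=> uv; rewrite (meetC crlB); apply/(residuation crlB).
  by rewrite (mul1x crlB).
case: (tot (h x i) (h y i)) => /le_imp ->.
  by rewrite (joinC crlB); apply/(le_joinE crlB)/(meet_ler crlB).
exact/(le_joinE crlB)/(meet_ler crlB).
Qed.

(** In a chain, the elements that are negative or fixed by the double star form
    a subuniverse: multiplication and the lattice operations return one of
    their arguments, [x ==> y] is one of [x^*] and [y], and a star is always
    fixed. Generation by the negative elements makes it everything. *)
Lemma GSM_chain_starstar (x : A) :
  (forall y z : A, y <= z \/ z <= y) -> e <= x -> x^*^* = x.
Proof.
move=> totA ex; have crlA := GSM_CRL.
have [_ gen] := gsmA.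
suff [xe|//] : x <= e \/ x^*^* = x.
  by rewrite (le_anti crlA xe ex) !(star1 crlA).
pose S (y : A) := y <= e \/ y^*^* = y.
have conserv (y z t : A) : S y -> S z -> t = y \/ t = z -> S t.
  by move=> Sy Sz [] ->.
have Sstar (y : A) : S (y^*) by right; exact: star3.
apply: (gen S); last by move=> y ye; left.
split=> [y z Sy Sz|].
  exact: conserv Sy Sz (mul_conserv crlA GSM_idempotent totA y z).
split=> [y z Sy Sz|].
  case: (EM (y <= z)) => yz.
    apply: conserv (Sstar y) Sz _ => /=.
    rewrite (imp_le_join crlA GSM_idempotent totA yz).
    exact: join_conserv crlA totA _ _.
  apply: conserv (Sstar y) Sz _ => /=.
  rewrite (imp_gt_meet crlA GSM_idempotent totA yz).
  exact: meet_conserv crlA totA _ _.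
split=> [y z Sy Sz|].
  exact: conserv Sy Sz (meet_conserv crlA totA y z).
split=> [y z Sy Sz|].
  exact: conserv Sy Sz (join_conserv crlA totA y z).
by split=> [|[]]; left; exact: lexx.
Qed.

End GSM.

(** * Epic subalgebras *)

Lemma subuniverse_image (C : Type) (A B : algebra C) (h : A -> B)
    (S : A -> Prop) : is_hom h -> is_subuniverse S ->
  is_subuniverse (fun y => exists2 x, S x & h x = y).
Proof.
move=> [hM [hI [hm [hj [he hc]]]]] [SM [SI [Sm [Sj [S1 Sc]]]]].
split=> [_ _ [x Sx <-] [y Sy <-]|].
  by exists (x * y); [exact: SM | exact: hM].
split=> [_ _ [x Sx <-] [y Sy <-]|].
  by exists (x ==> y); [exact: SI | exact: hI].
split=> [_ _ [x Sx <-] [y Sy <-]|].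
  by exists (x `&` y); [exact: Sm | exact: hm].
split=> [_ _ [x Sx <-] [y Sy <-]|].
  by exists (x `|` y); [exact: Sj | exact: hj].
split=> [|c]; first by exists e.
by exists (constant A c).
Qed.

Section Epimorphisms.

Context {C : Type} (K : algebra C -> Prop).
Hypothesis varK : is_variety K.
Hypothesis gsmK : forall A, K A -> is_GSM (reduct A).

Definition epic_in (B : algebra C) (S : B -> Prop) : Prop :=
  forall D, K D -> forall f g : B -> D, is_hom f -> is_hom g ->
    (forall x, S x -> f x = g x) -> forall y, f y = g y.

Lemma quotient_in_variety (A : algebra C) (R : A -> A -> Prop) :
  K A -> is_congruence R ->
  exists (D : algebra C) (q : A -> D),
    K D /\ is_hom q /\ Surjective q /\ forall x y, q x = q y <-> R x y.
Proof.
move=> KA /quotient_by[D [q [qhom [qsurj qE]]]].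
exists D, q; split=> //; exact: variety_hom_image qhom qsurj.
Qed.

Lemma chain_quotient_total (A D : algebra C) (q : A -> D) :
  (forall x y : A, x <= y \/ y <= x) -> is_hom q -> Surjective q ->
  forall x y : D, x <= y \/ y <= x.
Proof.
move=> totA qhom qsurj y y'.
have [[x <-] [x' <-]] := (qsurj y, qsurj y').
by case: (totA x x') => /(hom_le qhom); [left|right].
Qed.

(** If [T] misses a negative [x], identifying with [e] the members of [T] that
    are negative and not below [x] leaves [x] distinct from [e], but not
    separated from [e] by the image of [T]. The quotient map and its composite
    with the retraction of [collapse] then agree on [T] and differ at [x]. *)
Lemma chain_epic_full (A : algebra C) (T : A -> Prop) :
  K A -> (forall x y : A, x <= y \/ y <= x) -> is_subuniverse T ->
  epic_in T -> forall x, T x.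
Proof.
move=> KA totA subT epiT.
have [crlA idemA] := (GSM_CRL (gsmK KA), GSM_idempotent (gsmK KA)).
have Tstar := sub_star subT.
(* a positive [x] is recovered from the negative element [x^*] *)
suff Tneg x : x <= e -> T x.
  move=> x; case: (totA x e) => [/Tneg //|ex].
  rewrite -(GSM_chain_starstar (gsmK KA) totA ex).
  by apply: Tstar; apply: Tneg; exact: star_pos.
move=> xe; apply: contrapT => nTx.
have [TM [_ [_ [_ [T1 _]]]]] := subT.
pose F t := T t /\ t <= e /\ ~ t <= x.
have subF : neg_submonoid F.
  split; first by move=> t [_ []].
  split=> [|s t [Ts [se nsx]] [Tt [te ntx]]].
    split=> //; split=> [|ex]; first exact: lexx.
    by apply: nTx; rewrite (le_anti crlA xe ex).
  split; first exact: TM.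
  split; first exact: mul_neg.
  by case: (mul_conserv crlA idemA totA s t) => ->.
have [D [q [KD [qhom [qsurj qE]]]]] :=
  quotient_in_variety KA (eqmod_congruence crlA subF).
have [crlD idemD] := (GSM_CRL (gsmK KD), GSM_idempotent (gsmK KD)).
have totD := chain_quotient_total totA qhom qsurj.
have qsub := subuniverse_image qhom subT.
have [qM [qI [qm [_ [q1 _]]]]] := qhom.
have qle u v : q u <= q v -> exists2 a, F a & a * u <= v.
  rewrite /le -qm => /qE[a [Fa [_ auv]]]; exists a => //.
  exact: le_trans auv (meet_ler crlA _ _).
have F_above a : F a -> a * x = x.
  move=> [_ [ae nax]]; rewrite (mul_meet crlA idemA) ?(meetC crlA a).
    exact: nle_le nax.
  exact: mul_neg.
have nearx : near (fun y => exists2 t, T t & q t = y) (q x).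
  move=> _ [t Tt <-] net; split=> [/qle[a Fa]|qxt].
    rewrite F_above // => xt; apply: net.
    case: (totA t e) => [te|/(hom_le qhom)]; last by rewrite q1.
    have Ft : F t.
      by split=> //; split=> // tx; apply: nTx; rewrite (le_anti crlA xt tx).
    suff -> : q t = q e by rewrite q1; exact: lexx.
    apply/qE; exists t; rewrite (mulx1 crlA).
    by split=> //; split=> //; [exact: mul_neg | exact: lexx].
  apply: net; apply: le_trans qxt => //; apply: star_neg => //.
  by rewrite -q1; exact: hom_le.
have [r [rhom [rT rnear]]] := collapse crlD idemD totD qsub.
have qx1 : q x = q e.
  rewrite q1 -(rnear _ nearx); apply: (epiT D KD q (fun y => r (q y))) => //.
    exact: hom_comp.
  by move=> t Tt; rewrite rT //; exists t.
have [a Fa] : exists2 a, F a & a * e <= x.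
  by apply: qle; rewrite qx1; exact: lexx.
by rewrite (mulx1 crlA) => ax; case: Fa => _ [].
Qed.

Section Epic.

Context (B : algebra C) (S : B -> Prop).
Hypotheses (KB : K B) (subS : is_subuniverse S) (epiS : epic_in S).

Let crlB := GSM_CRL (gsmK KB).
Let idemB := GSM_idempotent (gsmK KB).

(** The quotient by a prime filter is a chain by prelinearity, and the image of
    an epic subalgebra in it is again epic. *)
Lemma epic_onto_prime (P : B -> Prop) x :
  prime_filter P -> exists2 s, S s & eqmod P s x.
Proof.
move=> [[Pmon Pup] Pprime].
have [D [q [KD [qhom [qsurj qE]]]]] :=
  quotient_in_variety KB (eqmod_congruence crlB Pmon).
have qle u v : P ((u ==> v) `&` e) -> q u <= q v.
  move=> Puv; have [_ [_ [qm _]]] := qhom; rewrite /le -qm; apply/qE.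
  exists ((u ==> v) `&` e); split=> //.
  have uve := meet_ler crlB (u ==> v) e; split.
    exact: le_trans (mul_negl crlB _ uve) (meet_lel crlB _ _).
  apply: meet_glb => //; first exact: mul_negl.
  by apply/(residuation crlB); exact: (meet_lel crlB).
have totD (u v : D) : u <= v \/ v <= u.
  have [[u' <-] [v' <-]] := (qsurj u, qsurj v).
  case: (Pprime ((u' ==> v') `&` e) ((v' ==> u') `&` e)); last 2 first.
  - by move/qle; left.
  - by move/qle; right.
  - exact: meet_ler.
  - exact: meet_ler.
  by rewrite GSM_prelinear; [case: Pmon => _ [] | exact: gsmK].
have epiD : epic_in (fun y => exists2 s, S s & q s = y).
  move=> E KE f g fhom ghom fg y; have [z <-] := qsurj y.
  apply: (epiS KE (f := fun z => f (q z)) (g := fun z => g (q z))).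
  - exact: hom_comp.
  - exact: hom_comp.
  by move=> s Ss; apply: fg; exists s.
have [s Ss qs] :=
  chain_epic_full KD totD (subuniverse_image qhom subS) epiD (q x).
by exists s => //; apply/qE.
Qed.

(** The relation [R] below is the composite of congruence modulo [P], congruence
    modulo [Q] inside [S], and congruence modulo [P]; permutability inside [S]
    makes it transitive. Choosing representatives in [S] modulo [Q] yields a
    homomorphism into [B/R] that agrees with the quotient map on [S]. *)
Lemma epic_interpolation (P Q : B -> Prop) b :
  neg_filter P -> neg_filter Q ->
  (forall x, exists2 s, S s & eqmod P s x) ->
  (forall x, exists2 s, S s & eqmod Q s x) ->
  exists2 u, S u & eqmod P u b /\ eqmod Q u b.
Proof.
move=> Pfilt Qfilt ontoP ontoQ.
have [Prefl [Psym [Ptrans Pcompat]]] := eqmod_congruence crlB (proj1 Pfilt).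
have [Qrefl [Qsym [Qtrans Qcompat]]] := eqmod_congruence crlB (proj1 Qfilt).
have permute := eqmod_permute crlB Pfilt Qfilt subS.
pose R x x' := exists s s',
  [/\ S s, S s', eqmod P s x, eqmod P s' x' & eqmod Q s s'].
have [SM [SI [Sm [Sj [S1 Sc]]]]] := subS.
have congR : is_congruence R.
  split=> [x|]; first by have [s Ss sx] := ontoP x; exists s, s.
  split=> [x y [s [s' [Ss Ss' sx sy ss']]]|].
    by exists s', s; split=> //; exact: Qsym.
  split=> [x y z [s [s' [Ss Ss' sx sy ss']]] [t [t' [St St' ty tz tt']]]|].
    have s't : eqmod P s' t by apply: Ptrans sy _; exact: Psym.
    have [v [Sv [s'v vt']]] := permute _ _ _ Ss' St St' s't tt'.
    by exists s, v; split=> //; [exact: Ptrans tz | exact: Qtrans s'v].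
  move=> x x' y y' [s [s' [Ss Ss' sx sx' ss']]] [t [t' [St St' ty ty' tt']]].
  have [p1 [p2 [p3 p4]]] := Pcompat _ _ _ _ sx ty.
  have [p1' [p2' [p3' p4']]] := Pcompat _ _ _ _ sx' ty'.
  have [q1 [q2 [q3 q4]]] := Qcompat _ _ _ _ ss' tt'.
  split; [|split; [|split]].
  - by exists (s * t), (s' * t'); split=> //; exact: SM.
  - by exists (s ==> t), (s' ==> t'); split=> //; exact: SI.
  - by exists (s `&` t), (s' `&` t'); split=> //; exact: Sm.
  - by exists (s `|` t), (s' `|` t'); split=> //; exact: Sj.
have [D [q [KD [qhom [_ qE]]]]] := quotient_in_variety KB congR.
have ontoQ' x : exists s, S s /\ eqmod Q s x.
  by have [s Ss sx] := ontoQ x; exists s.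
have [rep repP] := choice ontoQ'.
have q_rep s x : S s -> eqmod Q s x -> q (rep x) = q s.
  move=> Ss sx; have [Sr rx] := repP x; apply/qE.
  exists (rep x), s; split=> //; apply: Qtrans rx _; exact: Qsym.
have rephom : is_hom (fun x => q (rep x)).
  have [qM [qI [qm [qj [qe qc]]]]] := qhom.
  have Q2 x y := Qcompat _ _ _ _ (proj2 (repP x)) (proj2 (repP y)).
  have Sr x := proj1 (repP x).
  split=> [x y|].
    by rewrite -qM; apply: q_rep; [exact: SM | case: (Q2 x y)].
  split=> [x y|].
    by rewrite -qI; apply: q_rep; [exact: SI | case: (Q2 x y) => _ []].
  split=> [x y|].
    by rewrite -qm; apply: q_rep; [exact: Sm | case: (Q2 x y) => _ [_ []]].
  split=> [x y|].
    by rewrite -qj; apply: q_rep; [exact: Sj | case: (Q2 x y) => _ [_ []]].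
  by split=> [|c]; rewrite -?qe -?qc; exact: q_rep.
have /qE[s [s' [Ss Ss' sb s'b ss']]] : q b = q (rep b).
  apply: (epiS KD (f := q) (g := fun x => q (rep x))) => // t St.
  by rewrite (q_rep t).
have [Sr rb] := repP b.
have [v [Sv [vQ vP]]] :=
  eqmod_permute crlB Qfilt Pfilt subS Ss Ss' Sr ss' s'b.
exists v => //; split; last exact: Qtrans rb.
by apply: Ptrans sb; exact: Psym.
Qed.

(** Passage from two prime filters to all of [B], with the median of three
    approximations of [b] as majority term. *)
Lemma epic_full b : S b.
Proof.
apply: contrapT => nSb.
pose agree a s := a * s <= b /\ a * b <= s.
pose I a := a <= e /\ exists2 s, S s & agree a s.
have agree_join a c s : agree (a `|` c) s -> agree a s /\ agree c s.
  move=> [acs acb].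
  have weak d : d <= a `|` c -> agree d s.
    by move=> dac; split; [apply: le_trans acs|apply: le_trans acb];
      rewrite //; exact: le_mulr.
  by split; apply: weak; [exact: join_gel | exact: join_ger].
have agree_joinI a c s : agree a s -> agree c s -> agree (a `|` c) s.
  by move=> [as_ ab] [cs cb]; split; rewrite mul_joinl //; exact: join_lub.
have median d s t m : agree d s -> agree d t ->
    s `&` t <= m -> m <= s `|` t -> agree d m.
  move=> [ds db] [dt dbt] stm mst; split; last first.
    by apply: le_trans stm => //; exact: meet_glb.
  apply: le_trans (le_mul crlB (lexx crlB d) mst) _ => //.
  by rewrite mulC // mul_joinl // !(mulC crlB _ d); exact: join_lub.
have [||[_ [s Ss [sb bs]]]|P [Q [Pprime [Qprime PQ]]]] :=
    @prime_pair_avoiding C B crlB idemB I.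
- move=> a c ce ac [_ [s Ss [cs cb]]]; split; first exact: le_trans ac ce.
  by exists s => //; split; [apply: le_trans cs|apply: le_trans cb] => //;
    exact: le_mulr.
- move=> a c d ae ce de [_ [s Ss acs]] [_ [t St adt]] [_ [u Su cdu]].
  have [as_ cs] := agree_join _ _ _ acs; have [at_ dt] := agree_join _ _ _ adt.
  have [cu du] := agree_join _ _ _ cdu.
  split; first by do 2 (apply: join_lub => //).
  have [_ [_ [Sm [Sj _]]]] := subS.
  exists ((s `&` t) `|` ((s `&` u) `|` (t `&` u))).
    by apply: (Sj); [|apply: (Sj)]; exact: Sm.
  have [[ll lr] [jl jr]] :=
    ((meet_lel crlB, meet_ler crlB), (join_gel crlB, join_ger crlB)).
  apply: (agree_joinI); [|apply: (agree_joinI)].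
  - apply: median as_ at_ _ _; first exact: jl.
    apply: join_lub => //; [|apply: join_lub => //].
    + exact: le_trans (ll _ _) (jl _ _).
    + exact: le_trans (ll _ _) (jl _ _).
    exact: le_trans (ll _ _) (jr _ _).
  - apply: median cs cu _ _; first exact: le_trans (jl _ _) (jr _ _).
    apply: join_lub => //; [|apply: join_lub => //].
    + exact: le_trans (ll _ _) (jl _ _).
    + exact: le_trans (ll _ _) (jl _ _).
    exact: le_trans (lr _ _) (jr _ _).
  apply: median dt du _ _; first exact: le_trans (jr _ _) (jr _ _).
  apply: join_lub => //; [|apply: join_lub => //].
  + exact: le_trans (lr _ _) (jl _ _).
  + exact: le_trans (lr _ _) (jr _ _).
  exact: le_trans (ll _ _) (jl _ _).
- apply: nSb; move: sb bs; rewrite !mul1x // => sb bs.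
  by rewrite -(le_anti crlB sb bs).
have [u Su [[p [Pp [pu pb]]] [q [Qq [qu qb]]]]] :=
  epic_interpolation b (proj1 Pprime) (proj1 Qprime)
    (fun x => epic_onto_prime x Pprime) (fun x => epic_onto_prime x Qprime).
have [[[Pneg _] Pup] _] := Pprime; have [[[Qneg _] Qup] _] := Qprime.
have pqe : p `|` q <= e by apply: join_lub => //; [exact: Pneg|exact: Qneg].
apply: (PQ (p `|` q)).
- by apply: Pup Pp pqe _; exact: join_gel.
- by apply: Qup Qq pqe _; exact: join_ger.
split=> //; exists u => //; split; rewrite mul_joinl //; exact: join_lub.
Qed.

End Epic.

Lemma variety_ES (A B : algebra C) (h : A -> B) :
  is_epimorphism K h -> Surjective h.
Proof.
move=> [KA [KB [hhom hepi]]] y.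
pose S y := exists2 x, True & h x = y.
have subS : is_subuniverse S by apply: subuniverse_image hhom _; do !split.
have epiS : epic_in S.
  by move=> D KD f g fhom ghom fg; apply: hepi => // x; apply: fg; exists x.
by have [x _ <-] := epic_full KB subS epiS y; exists x.
Qed.

End Epimorphisms.

Theorem theorem7p3 :
  (forall K : algebra no_symbol -> Prop,
     is_finitely_generated_variety K ->
     (forall A : algebra no_symbol, K A -> is_GSM A) ->
     forall (A B : algebra no_symbol) (h : A -> B),
       is_epimorphism K h -> Surjective h)
  /\
  (forall K : algebra bottom_symbol -> Prop,
     is_finitely_generated_variety K ->
     (forall A : algebra bottom_symbol, K A -> is_bounded_GSM A) ->
     forall (A B : algebra bottom_symbol) (h : A -> B),
       is_epimorphism K h -> Surjective h).
Proof.
split=> K [? [_ [varK _]]] gsmK A B h; apply: variety_ES => // D KD.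
  have -> : reduct D = D; last exact: gsmK.
  by case: (D) => * /=; congr Algebra; apply: funext => -[].
by case: (gsmK D KD).
Qed.
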